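(* Let $T$ and $\Omega$ be bounded positive operators on $L^2(G,\mathbb{C}^{s\times r})$ that are adjointable with respect to the matrix-valued inner product, and let $\{E_k\}_{k\in\mathbb{N}}$ be a matrix-valued orthonormal basis for $L^2(G,\mathbb{C}^{s\times r})$ such that $\{TE_k\}_{k\in\mathbb{N}}$ is a matrix-valued Riesz basis. If $\mathrm{tr}\langle T\mathbf{f},\mathbf{f}\rangle\le\mathrm{tr}\langle\Omega\mathbf{f},\mathbf{f}\rangle$ for all $\mathbf{f}\in L^2(G,\mathbb{C}^{s\times r})$, then $\{\Omega E_k\}_{k\in\mathbb{N}}$ is a matrix-valued Riesz basis for $L^2(G,\mathbb{C}^{s\times r})$.
   Context: $G$ is a locally compact abelian group that is metrizable and $\sigma$-compact, with Haar measure $\mu_G$; $s,r\in\mathbb{N}$. $L^2(G,\mathbb{C}^{s\times r})$ is the space of $s\times r$ matrices with all entries in $L^2(G)$. The matrix-valued inner product is $\langle \mathbf{f},\mathbf{g}\rangle=\int_G \mathbf{f}(x)\mathbf{g}^*(x)\,d\mu_G\in M_s(\mathbb{C})$ (entrywise integral). $L^2(G,\mathbb{C}^{s\times r})$ is a Hilbert space with inner product $\langle \mathbf{f},\mathbf{g}\rangle_{L^2}=\mathrm{tr}\langle \mathbf{f},\mathbf{g}\rangle$ and Frobenius norm; $U^*$ denotes the Hilbert-adjoint with respect to this inner product. $U$ is adjointable with respect to the matrix-valued inner product if $\langle U\mathbf{f},\mathbf{g}\rangle=\langle\mathbf{f},U^*\mathbf{g}\rangle$ for all $\mathbf{f},\mathbf{g}$.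 A bounded operator $P$ is positive if $P^*=P$ and $\mathrm{tr}\langle P\mathbf{f},\mathbf{f}\rangle\ge0$ for all $\mathbf{f}$. A matrix-valued orthonormal basis is a sequence $\{E_k\}_{k\in\mathbb{N}}$ with $\langle E_k,E_j\rangle=\mathbf{I}_{s\times s}$ if $k=j$ and $\mathbf{O}_{s\times s}$ otherwise, such that $\mathbf{f}=\sum_k\langle\mathbf{f},E_k\rangle E_k$ in Frobenius norm for all $\mathbf{f}$. A matrix-valued Riesz basis is a family $\{VE_k\}_{k\in\mathbb{N}}$ with $\{E_k\}$ a matrix-valued orthonormal basis and $V$ bounded, linear, bijective and adjointable with respect to the matrix-valued inner product. *)

(* Defs.v *)
(* mathcomp-analysis (measure theory / Lebesgue integration)
   + real-closed's complex numbers R[i]. *)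
From HB Require Import structures.
From mathcomp Require Import all_boot all_algebra.
From mathcomp Require Import all_classical all_reals all_analysis.
From mathcomp Require Import complex.
Import GRing.Theory Num.Theory numFieldTopology.Exports numFieldNormedType.Exports.
Set Implicit Arguments.
Unset Strict Implicit.
Unset Printing Implicit Defensive.
Local Open Scope ring_scope.
Local Open Scope classical_set_scope.

(* The Borel sigma-algebra of a topological abelian group G.           *)
Definition borelG (G : topologicalZmodType) : Type := G.

HB.instance Definition _ (G : topologicalZmodType) := Choice.on (borelG G).
HB.instance Definition _ (G : topologicalZmodType) :=
  isPointed.Build (borelG G) (0 : G).
(* G with its Borel sigma-algebra (generated by the open sets) *)
Definition Gborel (G : topologicalZmodType) : measurableType _ :=
  g_sigma_algebraType (@open G : set (set (borelG G))).

(* Topological hypotheses on G.                                        *)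
(* G is metrizable: some metric induces its topology. *)
Definition metrizable (R : realType) (G : topologicalZmodType) : Prop :=
  exists d : G -> G -> R,
    [/\ forall x y, 0 <= d x y,
        forall x y, d x y = 0 <-> x = y,
        forall x y, d x y = d y x,
        forall x y z, d x z <= d x y + d y z &
        forall A : set G, open A <->
          (forall x, A x -> exists2 e : R, 0 < e & [set y | d x y < e] `<=` A)].

(* G is sigma-compact *)
Definition sigma_compact (G : topologicalZmodType) : Prop :=
  exists K : nat -> set G, (forall n, compact (K n)) /\ \bigcup_n K n = setT.

(* mu is a Haar measure on G (on the Borel sets): translation invariant,
   finite on compact sets, positive on nonempty open sets.  (For a
   sigma-compact metrizable locally compact group every Borel measure
   finite on compact sets is automatically regular.) *)
Definition haar_measure (R : realType) (G : topologicalZmodType)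
    (mu : {measure set (Gborel G) -> \bar R}) : Prop :=
  [/\ forall (A : set G) (a : G), measurable (A : set (Gborel G)) ->
        mu [set x + a | x in A] = mu A,
      forall K : set G, compact K -> (mu K < +oo)%E &
      forall U : set G, open U -> U !=set0 -> (0 < mu U)%E].

(* L^2(G, C^{s x r}) and the matrix-valued inner product.              *)
(* Elements are represented by functions G -> 'M[R[i]]_(s, r);         *)
(* equality in L^2 is equality up to a null function (eqL2).           *)
Section L2.
Variables (R : realType) (G : topologicalZmodType)
  (mu : {measure set (Gborel G) -> \bar R}) (s r : nat).

Local Notation C := (R[i]).
Local Notation Mf := (G -> 'M[C]_(s, r)).

(* every entry is measurable and square integrable *)
Definition isL2 (f : Mf) : Prop :=
  forall (i : 'I_s) (j : 'I_r),
    [/\ measurable_fun setT (fun x : Gborel G => complex.Re (f x i j)),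
        measurable_fun setT (fun x : Gborel G => complex.Im (f x i j)) &
        mu.-integrable setT (fun x : Gborel G =>
          ((complex.Re (f x i j)) ^+ 2 + (complex.Im (f x i j)) ^+ 2)%:E)].

(* integral of a complex valued function *)
Definition cintegral (h : G -> C) : C :=
  Complex (Rintegral mu setT (fun x : Gborel G => complex.Re (h x)))
          (Rintegral mu setT (fun x : Gborel G => complex.Im (h x))).

(* conjugate transpose *)
Definition adjmx (A : 'M[C]_(s, r)) : 'M[C]_(r, s) :=
  (map_mx (fun z : C => z^*) A)^T.

(* matrix valued inner product <f,g> = \int_G f(x) g(x)^* dmu (entrywise) *)
Definition mip (f g : Mf) : 'M[C]_s :=
  \matrix_(i, j) cintegral (fun x => (f x *m adjmx (g x)) i j).

(* Hilbert space inner product <f,g>_{L^2} = tr <f,g> *)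
Definition ipL2 (f g : Mf) : C := \tr (mip f g).

(* squared Frobenius L^2 norm *)
Definition nrm2 (f : Mf) : R := complex.Re (ipL2 f f).

(* equality in L^2 *)
Definition eqL2 (f g : Mf) : Prop := nrm2 (fun x => f x - g x) = 0.

(* Operators on L^2.                                                   *)
Definition preservesL2 (U : Mf -> Mf) : Prop :=
  forall f, isL2 f -> isL2 (U f).

Definition linearL2 (U : Mf -> Mf) : Prop :=
  forall (a b : C) (f g : Mf), isL2 f -> isL2 g ->
    eqL2 (U (fun x => a *: f x + b *: g x)) (fun x => a *: U f x + b *: U g x).

(* bounded linear operator *)
Definition boundedL2 (U : Mf -> Mf) : Prop :=
  [/\ preservesL2 U, linearL2 U &
      exists K : R, forall f, isL2 f -> nrm2 (U f) <= K * nrm2 f].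

(* adjointable with respect to the matrix valued inner product *)
Definition adjointable (U : Mf -> Mf) : Prop :=
  exists V : Mf -> Mf, preservesL2 V /\
    forall f g, isL2 f -> isL2 g -> mip (U f) g = mip f (V g).

(* P^* = P (self-adjoint for the Hilbert inner product) *)
Definition selfadjointL2 (P : Mf -> Mf) : Prop :=
  forall f g, isL2 f -> isL2 g -> ipL2 (P f) g = ipL2 f (P g).

(* positive bounded operator *)
Definition positiveL2 (P : Mf -> Mf) : Prop :=
  [/\ boundedL2 P, selfadjointL2 P &
      forall f, isL2 f -> 0 <= ipL2 (P f) f].

(* bijective on L^2 (up to L^2 equality) *)
Definition bijectiveL2 (V : Mf -> Mf) : Prop :=
  (forall f g, isL2 f -> isL2 g -> eqL2 (V f) (V g) -> eqL2 f g) /\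
  (forall g, isL2 g -> exists2 f, isL2 f & eqL2 (V f) g).

(* matrix-valued orthonormal basis *)
Definition mv_onb (E : nat -> Mf) : Prop :=
  [/\ forall k, isL2 (E k),
      forall k j, mip (E k) (E j) = if k == j then 1%:M else 0 &
      forall f, isL2 f ->
        nrm2 (fun x => f x - \sum_(k < n) (mip f (E k) *m E k x))
          @[n --> \oo] --> (0 : R)].

(* matrix-valued Riesz basis *)
Definition mv_riesz (F : nat -> Mf) : Prop :=
  exists (E : nat -> Mf) (V : Mf -> Mf),
    [/\ mv_onb E, boundedL2 V, bijectiveL2 V, adjointable V &
        forall k, eqL2 (F k) (V (E k))].

End L2.

(* Main.v *)
(** Taking [V = Om] and the given basis [E], only the bijectivity of [Om] is at stake.
    Since [T E_k] is a Riesz basis, every [g] satisfies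
    [|<g, x>|^2 <= K <T x, x> <= K <Om x, x>] for all [x], with [K] depending on [g].
    By a gliding hump argument in the complete space [L^2] this forces [Om] to be
    coercive, [c |x|^2 <= <Om x, x>].  A bounded coercive operator is injective, and it
    is surjective because the iteration [f_(n+1) = f_n + tau (g - Om f_n)] converges
    geometrically to a solution of [Om f = g]. *)
Require Import Defs.
From HB Require Import structures.
From mathcomp Require Import all_boot all_order all_algebra.
From mathcomp Require Import all_classical all_reals all_analysis.
From mathcomp Require Import measurable_realfun.
From mathcomp Require Import complex zify ring lra.
Import Order.TTheory GRing.Theory Num.Theory numFieldTopology.Exports numFieldNormedType.Exports.
Local Open Scope ring_scope.
Local Open Scope classical_set_scope.

Local Notation "x %:C" := (real_complex _ x) : ring_scope.

(** Why the Riesz property yields domination: [T] acts like a bijection composed with a change of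
    orthonormal basis, so formally every [g] is some [T f], and Cauchy-Schwarz for the form of [T]
    gives <g, x>^2 <= <T f, f> <T x, x>. Finite expansions of bounded norm replace [f] in the proof.
    Domination is the version of surjectivity that survives the comparison with [Om]: the order
    relates the quadratic forms and says nothing directly about ranges. Its constant depends on [g],
    so coercivity is a uniform boundedness statement, and the gliding hump supplies the uniformity.
    Vectors are functions and equality is the vanishing of a seminorm, so operator identities hold
    only when paired with a test vector; the abstract part is phrased with such pairings.
    Completeness is stated for sequences with geometric increments, which both the humps and the
    iteration produce. *)

Lemma le0_of_geometric (R : realType) (x M t : R) :
  0 < t < 1 -> (forall n, x <= M * t ^+ n) -> x <= 0.
Proof.
move=> /andP[t0 t1] H.
have tn : `|t| < 1 by rewrite gtr0_norm.
have hc := cvg_geometric M tn.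
rewrite -(cvg_lim (@Rhausdorff R) hc); apply: limr_ge.
  by apply/cvg_ex; exists 0.
exact: nearW.
Qed.

(** * Real semi-inner products *)

(* [b] is a form on the elements satisfying [D], to be taken as the real part of the
   Hilbert inner product on the square integrable functions, or as [Re <U f, g>]. *)
Record semi_inner (R : realType) (X : lmodType R[i]) (D : X -> Prop)
    (b : X -> X -> R) : Prop := SemiInner {
  si0 : D 0;
  siD : forall x y, D x -> D y -> D (x + y);
  siZ : forall (a : R) x, D x -> D (a%:C *: x);
  siC : forall x y, D x -> D y -> b x y = b y x;
  siDl : forall x y z, D x -> D y -> D z -> b (x + y) z = b x z + b y z;
  siZl : forall (a : R) x y, D x -> D y -> b (a%:C *: x) y = a * b x y;
  si_ge0 : forall x, D x -> 0 <= b x x }.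

Arguments semi_inner {R X} D b.
Arguments si0 {R X D b}. Arguments siD {R X D b}. Arguments siZ {R X D b}.
Arguments siC {R X D b}. Arguments siDl {R X D b}. Arguments siZl {R X D b}.
Arguments si_ge0 {R X D b}.

Section SemiInner.
Context {R : realType} {X : lmodType R[i]} {D : X -> Prop} {b : X -> X -> R}.
Hypothesis S : semi_inner D b.

Lemma siN x : D x -> D (- x).
Proof. by move=> /(siZ S (-1)); rewrite rmorphN rmorph1 scaleN1r. Qed.

Lemma siB x y : D x -> D y -> D (x - y).
Proof. by move=> Dx Dy; apply: (siD S) => //; apply: siN. Qed.

Lemma siDr x y z : D x -> D y -> D z -> b z (x + y) = b z x + b z y.
Proof.
move=> Dx Dy Dz; rewrite (siC S z) ?(siDl S) //; last exact: (siD S).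
by rewrite (siC S x) // (siC S y).
Qed.

Lemma siZr a x y : D x -> D y -> b y (a%:C *: x) = a * b y x.
Proof.
move=> Dx Dy; rewrite (siC S y) ?(siZl S) //; last exact: (siZ S).
by rewrite (siC S x).
Qed.

Lemma siNl x y : D x -> D y -> b (- x) y = - b x y.
Proof.
by move=> Dx Dy; rewrite -(scaleN1r x) -(rmorph1 (real_complex R)) -rmorphN (siZl S)// mulN1r.
Qed.

Lemma siNr x y : D x -> D y -> b y (- x) = - b y x.
Proof.
by move=> Dx Dy; rewrite (siC S y) ?siNl // ?(siC S x) //; exact: siN.
Qed.

Lemma siBl x y z : D x -> D y -> D z -> b (x - y) z = b x z - b y z.
Proof. by move=> Dx Dy Dz; rewrite (siDl S) ?siNl //; exact: siN. Qed.

Lemma siBr x y z : D x -> D y -> D z -> b z (x - y) = b z x - b z y.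
Proof.
move=> Dx Dy Dz; rewrite (siC S z) ?siBl //; last exact: siB.
by rewrite (siC S x) // (siC S y).
Qed.

Lemma si_sqB (a : R) x y : D x -> D y ->
  b (x - a%:C *: y) (x - a%:C *: y) = b x x - 2 * a * b x y + a ^+ 2 * b y y.
Proof.
move=> Dx Dy; have Day := siZ S a _ Dy.
rewrite siBl ?siBr ?(siZl S) ?siZr //; last exact: siB.
by rewrite (siC S y x) //; ring.
Qed.

Lemma si_CS x y : D x -> D y -> b x y ^+ 2 <= b x x * b y y.
Proof.
move=> Dx Dy.
have key (a : R) : 0 <= b x x - 2 * a * b x y + a ^+ 2 * b y y.
  by rewrite -si_sqB //; apply: (si_ge0 S); apply: siB => //; exact: (siZ S).
have := si_ge0 S _ Dy; rewrite le_eqVlt => /predU1P[y0|y0].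
  rewrite -y0 mulr0; case: (eqVneq (b x y) 0) => [->|n0]; first by rewrite expr0n.
  (* When [b y y = 0] the expression in [key] is affine in [a]; this choice gives it the value
     -1. *)
  have := key ((b x x + 1) / (2 * b x y)); rewrite -y0 mulr0 addr0.
  have -> : 2 * ((b x x + 1) / (2 * b x y)) * b x y = b x x + 1 by field.
  lra.
have := key (b x y / b y y).
have -> : b x x - 2 * (b x y / b y y) * b x y + (b x y / b y y) ^+ 2 * b y y
  = b x x - b x y ^+ 2 / b y y.
  by field; rewrite gt_eqF.
by rewrite subr_ge0 ler_pdivrMr.
Qed.

Lemma si_null x y : D x -> D y -> b x x = 0 -> b x y = 0.
Proof.
move=> Dx Dy x0; have := si_CS x y Dx Dy; rewrite x0 mul0r => h.
by apply/eqP; rewrite -sqrf_eq0 eq_le h sqr_ge0.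
Qed.

Lemma si_sqD_le x y : D x -> D y -> b (x + y) (x + y) <= 2 * b x x + 2 * b y y.
Proof.
move=> Dx Dy.
have h := si_ge0 S _ (siB _ _ Dx Dy).
rewrite siBl ?siBr // in h; last exact: siB.
rewrite (siDl S) ?siDr //; last exact: (siD S).
rewrite (siC S y x) // in h *; lra.
Qed.

Lemma si_sq_leB x y : D x -> D y -> b y y <= 2 * b x x + 2 * b (x - y) (x - y).
Proof.
move=> Dx Dy; have Dxy := siB _ _ Dx Dy.
have := si_sqD_le _ _ Dx (siN _ Dxy).
rewrite siNl ?siNr ?opprK //; last exact: siN.
by rewrite opprB addrC subrK.
Qed.

Lemma si_le2 x y : D x -> D y -> 2 * b x y <= b x x + b y y.
Proof.
move=> Dx Dy.
have h := si_ge0 S _ (siB _ _ Dx Dy).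
rewrite siBl ?siBr // in h; last exact: siB.
rewrite (siC S y x) // in h; lra.
Qed.

(* The ratio is [t^4] in the hypothesis and [t^2] in the conclusion, so that only
   integral powers of [t] occur. *)
Definition geometrically_complete := forall (s : nat -> X) (C t : R),
  0 < t < 1 -> (forall n, D (s n)) ->
  (forall n, b (s n.+1 - s n) (s n.+1 - s n) <= C * t ^+ (4 * n)) ->
  exists f, D f /\
    exists C' : R, forall n, b (f - s n) (f - s n) <= C' * t ^+ (2 * n).

Hypothesis complete : geometrically_complete.

(** * Coercivity from domination of every linear functional [b g] *)

Section Coercive.
Variable q : X -> R.
Hypothesis q_ge0 : forall x, D x -> 0 <= q x.
Hypothesis qZ : forall (a : R) x, D x -> q (a%:C *: x) = a ^+ 2 * q x.
Hypothesis q_dom : forall g, D g -> exists C : R,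
  forall x, D x -> b g x ^+ 2 <= C * q x.

(* Gliding hump: unit vectors [h n] with [q (h n) < 32^-n] are combined into
   [g = sum_k (+/-) 4^-k h k] with [|b g (h n)|] of order [4^-n], against [q_dom]. *)
Lemma coercive_of_dominated : exists c : R,
  0 < c /\ forall x, D x -> c * b x x <= q x.
Proof.
apply: contrapT => nocoer.
(* The base 32 must exceed 16: the squared pairing of [g] with the n-th hump will be of order 16^-n,
   while domination bounds it by a multiple of 32^-n. *)
have hump (n : nat) : exists x, [/\ D x, b x x = 1 & q x < 32^-1 ^+ n].
  have e0 : 0 < 32^-1 ^+ n :> R by rewrite exprn_gt0.
  have [x] : exists x, D x /\ q x < 32^-1 ^+ n * b x x.
    apply: contrapT => no; apply: nocoer; exists (32^-1 ^+ n); split => // x Dx.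
    by rewrite leNgt; apply/negP => h; apply: no; exists x.
  move=> [Dx hx].
  have xx0 : 0 < b x x by rewrite -(pmulr_rgt0 _ e0); apply: le_lt_trans hx; exact: q_ge0.
  have sx0 : 0 < Num.sqrt (b x x) by rewrite sqrtr_gt0.
  have sx2 : (Num.sqrt (b x x))^-1 ^+ 2 * b x x = 1.
    by rewrite exprVn sqr_sqrtr ?(ltW xx0)// mulVf // gt_eqF.
  exists (((Num.sqrt (b x x))^-1)%:C *: x); split.
  - exact: (siZ S).
  - rewrite (siZl S) ?siZr //; last exact: (siZ S).
    by rewrite mulrA -expr2.
  - rewrite qZ // [_^-1 ^+ 2]exprVn sqr_sqrtr ?(ltW xx0)// mulrC ltr_pdivrMr //.
have [h hP] := choice hump.
have Dh n : D (h n) by have [] := hP n.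
have h1 n : b (h n) (h n) = 1 by have [] := hP n.
have hq n : q (h n) < 32^-1 ^+ n by have [] := hP n.
pose e n : R := 4^-1 ^+ n.
have e0 n : 0 < e n by rewrite /e exprn_gt0.
have eS n : e n.+1 = e n / 4 by rewrite /e exprSr.
(* The new hump gets the sign of its pairing with the current partial sum, so that adding it makes
   the absolute value of this pairing at least [e n]. *)
pose sg n (s : X) : R := if 0 <= b s (h n) then 1 else -1.
pose s := fix s n := if n is m.+1 then s m + (sg m (s m) * e m)%:C *: h m else 0.
have sE n : s n.+1 = s n + (sg n (s n) * e n)%:C *: h n by [].
have Ds n : D (s n).
  elim: n => [|n IH]; first exact: (si0 S).
  by rewrite sE; apply: (siD S) => //; apply: (siZ S).
have sg2 n : sg n (s n) ^+ 2 = 1 by rewrite /sg; case: ifP => _; rewrite ?sqrrN expr1n.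
have sg1 n : `|sg n (s n)| = 1 by rewrite /sg; case: ifP => _; rewrite ?normrN normr1.
(* The squared increments are exactly 16^-n, the fourth power of 2^-n. *)
have [|n|g [Dg [C' gs]]] := complete s 1 2^-1 _ Ds.
- by apply/andP; split; lra.
- rewrite sE addrAC subrr add0r (siZl S) ?siZr //; last exact: (siZ S).
  rewrite h1 mulr1 mul1r -expr2 exprMn sg2 mul1r /e -exprM.
  have -> : (4^-1 : R) = 2^-1 ^+ 2 by rewrite exprVn; congr (_^-1); ring.
  by rewrite -exprM (_ : (2 * (n * 2) = 4 * n)%N) //; lia.
have bh x n : D x -> `|b x (h n)| ^+ 2 <= b x x.
  by move=> Dx; rewrite real_normK ?num_real // -[leRHS]mulr1 -(h1 n); exact: si_CS.
(* The pairing is at least [e n] once hump [n] is added, and a later hump [k] changes it by at most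
   [e k]. The subtracted fraction is the sum of [e k] over n < k < m. *)
have tail n m : (n < m)%N -> e n - (e n - e m * 4) / 3 <= `|b (s m) (h n)|.
  elim: m => // m IH; rewrite ltnS leq_eqVlt => /predU1P[->|nm].
    rewrite sE (siDl S) ?(siZl S) ?h1 //; last exact: (siZ S).
    rewrite mulr1 eS; have := e0 m.
    rewrite /sg; case: ifPn => [p|]; last rewrite -ltNge => p.
      by rewrite mul1r ger0_norm; [lra|rewrite addr_ge0 // ltW].
    by move=> em; rewrite mulN1r ler0_norm; lra.
  have {}IH := IH nm; rewrite sE (siDl S) ?(siZl S) //; last exact: (siZ S).
  have bmn : `|sg m (s m) * e m * b (h m) (h n)| <= e m.
    rewrite !normrM sg1 mul1r (gtr0_norm (e0 m)) ler_piMr ?(ltW (e0 m)) //.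
    by rewrite -(@ler_pXn2r _ 2) ?nnegrE // expr1n -(h1 m) bh.
  have := lerB_normD (b (s m) (h n)) (sg m (s m) * e m * b (h m) (h n)).
  by rewrite eS; lra.
have [C gC] := q_dom g Dg.
(* With w = 2^-N, the partial sum at [3 * N] pairs with [h N] to at least (2/3) w^2 and differs from
   [g] there by at most order w^3. Squaring gives (4/9) w^4 <= 2 |C| w^5 + 2 C' w^6, which bounds
   1/w. Taking N = n + 1 ensures N < 3 N. *)
have fin (n : nat) : 2 ^+ n.+1 <= 9 / 2 * (`|C| + C') :> R.
  set N := n.+1.
  have lo : e N * (2 / 3) <= `|b (s (3 * N)%N) (h N)|.
    by apply: le_trans (tail N (3 * N)%N _); [have := e0 (3*N)%N; lra | rewrite ltn_Pmull].
  have up1 : b g (h N) ^+ 2 <= `|C| * 32^-1 ^+ N.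
    apply: le_trans (gC _ (Dh N)) _; apply: le_trans (_ : `|C| * q (h N) <= _).
      by apply: ler_wpM2r; [exact: q_ge0 | exact: ler_norm].
    by apply: ler_wpM2l => //; exact: ltW.
  have up2 : (b g (h N) - b (s (3 * N)%N) (h N)) ^+ 2 <= C' * 2^-1 ^+ (2 * (3 * N)).
    rewrite -siBl //; apply: le_trans (gs _).
    by rewrite -[leRHS]mulr1 -(h1 N); apply: si_CS => //; exact: siB.
  have up3 : (e N * (2 / 3)) ^+ 2 <= 2 * (`|C| * 32^-1 ^+ N) + 2 * (C' * 2^-1 ^+ (2 * (3 * N))).
    apply: le_trans (_ : b (s (3 * N)%N) (h N) ^+ 2 <= _).
      rewrite -(real_normK (num_real (b (s _) _))) ler_pXn2r ?nnegrE //.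
      by rewrite mulr_ge0 // ?(ltW (e0 _)) //; lra.
    have := sqr_ge0 (b g (h N) + (b g (h N) - b (s (3 * N)%N) (h N))).
    nra.
  have C'0 : 0 <= C'.
    by have := le_trans (si_ge0 S _ (siB _ _ Dg (Ds 0%N))) (gs 0%N); rewrite mulr1.
  pose w : R := 2^-1 ^+ N.
  have w0 : 0 < w by rewrite exprn_gt0.
  have w1 : w <= 1 by rewrite exprn_ile1 //; lra.
  have eqe : e N = w ^+ 2.
    by rewrite /e /w -!exprM mulnC exprM; congr (_ ^+ _); field.
  have eq32 : 32^-1 ^+ N = w ^+ 5 :> R.
    by rewrite /w -!exprM mulnC exprM; congr (_ ^+ _); field.
  have eq64 : 2^-1 ^+ (2 * (3 * N)) = w ^+ 6 :> R by rewrite /w -exprM; congr (_ ^+ _); lia.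
  rewrite eqe eq32 eq64 in up3.
  have -> : 2 ^+ N = w^-1 by rewrite /w exprVn invrK.
  rewrite -div1r ler_pdivrMr // -(ler_pM2l (_ : 0 < w ^+ 4)) ?exprn_gt0 //.
  have : C' * w ^+ 6 <= C' * w ^+ 5.
    by apply: ler_wpM2l => //; rewrite (exprS _ 5) ler_piMl // exprn_ge0 // ltW.
  have -> : w ^+ 4 * 1 = 9 / 4 * (w ^+ 2 * (2 / 3)) ^+ 2 by field.
  have -> : w ^+ 4 * (9 / 2 * (`|C| + C') * w) = 9 / 4 * (2 * (`|C| * w ^+ 5) + 2 * (C' * w ^+ 5)) by field.
  lra.
have := fin (Num.bound (9 / 2 * (`|C| + C'))).
by rewrite leNgt upper_nthrootP.
Qed.
End Coercive.

(** Transfers norms between vectors that may differ by a null vector; this is how the weak linearity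
    of [U] is used inside a norm. *)
Lemma si_weak_eq x y : D x -> D y -> (forall z, D z -> b x z = b y z) ->
  b x x = b y y.
Proof. by move=> Dx Dy h; rewrite h // (siC S y) // h. Qed.

(** * Bounded self-adjoint operators with a coercive form *)

Section Operator.
Variable U : X -> X.
Hypothesis DU : forall x, D x -> D (U x).
(* [U] is additive only up to null vectors, hence the weak formulation. *)
Hypothesis UL : forall (a : R) x y z, D x -> D y -> D z ->
  b (U (x + a%:C *: y)) z = b (U x) z + a * b (U y) z.
Hypothesis UC : forall x y, D x -> D y -> b (U x) y = b x (U y).

Lemma operator_form : (forall x, D x -> 0 <= b (U x) x) ->
  semi_inner D (fun x y => b (U x) y).
Proof.
move=> Uge0; have D0 := si0 S.
have U0 z : D z -> b (U 0) z = 0.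
  by move=> Dz; have := UL 1 0 0 z D0 D0 Dz; rewrite scaler0 addr0 mul1r; lra.
split => //; first [exact: (siD S)|exact: (siZ S)|idtac].
- by move=> x y Dx Dy; rewrite (UC x y Dx Dy) (siC S x (U y)) //; exact: DU.
- by move=> x y z Dx Dy Dz; have := UL 1 x y z Dx Dy Dz; rewrite rmorph1 scale1r mul1r.
- by move=> a x y Dx Dy; have := UL a 0 x y D0 Dx Dy; rewrite add0r U0 ?add0r.
Qed.

Variables (K c : R).
Hypothesis UK : forall x, D x -> b (U x) (U x) <= K * b x x.
Hypothesis c0 : 0 < c.
Hypothesis Uc : forall x, D x -> c * b x x <= b (U x) x.

Lemma coercive_inj x y : D x -> D y -> b (U x - U y) (U x - U y) = 0 ->
  b (x - y) (x - y) = 0.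
Proof.
move=> Dx Dy U0; have Dxy := siB _ _ Dx Dy; have [DUx DUy] := (DU _ Dx, DU _ Dy).
have e : b (U (x - y)) (x - y) = b (U x - U y) (x - y).
  have := UL (-1) x y (x - y) Dx Dy Dxy.
  by rewrite rmorphN rmorph1 scaleN1r siBl // => ->; ring.
have := Uc _ Dxy; rewrite e (si_null (U x - U y)) //; last exact: siB.
rewrite pmulr_rle0 // => h; apply/eqP; rewrite eq_le h; exact: (si_ge0 S).
Qed.

(* Richardson iteration [f_(n+1) = f_n + tau (g - U f_n)]. *)
Lemma coercive_surj g : D g -> exists2 f, D f & b (U f - g) (U f - g) = 0.
Proof.
move=> Dg.
(* For a residual r, |r - tau U r|^2 <= (1 - 2 tau c + tau^2 L) |r|^2, and tau = c / L minimises the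
   factor, with value [th]. [L] dominates [K] for the estimate and exceeds c^2 so that [th] is
   positive. *)
pose L := `|K| + c ^+ 2 + 1; pose tau := c / L; pose th := 1 - c ^+ 2 / L.
have L0 : 0 < L by rewrite /L; have := normr_ge0 K; have := sqr_ge0 c; lra.
have th01 : 0 < th < 1.
  have cL : 0 < c ^+ 2 / L by rewrite divr_gt0 // exprn_gt0.
  have : c ^+ 2 / L < 1 by rewrite ltr_pdivrMr // mul1r /L; have := normr_ge0 K; lra.
  by rewrite /th; lra.
have th0 : 0 < th by case/andP: th01.
(* The fourth root matches the ratio t^4 demanded by [geometrically_complete]. *)
pose t := Num.sqrt (Num.sqrt th).
have t4 : t ^+ 4 = th by rewrite (exprM _ 2 2) !sqr_sqrtr // ?sqrtr_ge0 // ltW.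
have t01 : 0 < t < 1.
  rewrite !sqrtr_gt0 th0 /= -[ltRHS](@sqrtr1 R) ltr_sqrt // -[ltRHS](@sqrtr1 R) ltr_sqrt //.
  by case/andP: th01.
pose f := fix f n := if n is m.+1 then f m + tau%:C *: (g - U (f m)) else 0.
have fE n : f n.+1 = f n + tau%:C *: (g - U (f n)) by [].
have Df n : D (f n).
  elim: n => [|n IH]; first exact: (si0 S).
  rewrite fE; apply: (siD S) => //; apply: (siZ S).
  by apply: siB => //; exact: DU.
have Drho n : D (g - U (f n)) by apply: siB => //; exact: DU.
have DUf n : D (U (f n)) by exact: DU.
have rho n : b (g - U (f n)) (g - U (f n)) <= b (g - U (f 0%N)) (g - U (f 0%N)) * th ^+ n.
  elim: n => [|n IH]; first by rewrite mulr1.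
  have DUr := DU _ (Drho n).
  (* The recursion r_(n+1) = r_n - tau U r_n for residuals holds only up to a null vector, so just
     the norms are identified. *)
  have -> : b (g - U (f n.+1)) (g - U (f n.+1)) =
    b (g - U (f n) - tau%:C *: U (g - U (f n))) (g - U (f n) - tau%:C *: U (g - U (f n))).
    apply: si_weak_eq => //; first by apply: siB => //; exact: (siZ S).
    move=> z Dz; rewrite fE siBl //; last by rewrite -fE.
    rewrite UL // [RHS]siBl //; last exact: (siZ S).
    by rewrite siBl // (siZl S) //; ring.
  rewrite si_sqB // (exprS th n) [leRHS]mulrCA.
  apply: le_trans (ler_wpM2l (ltW th0) IH).
  set r := g - U (f n) in IH Drho DUr *; have Dr : D r by exact: Drho.
  have r0 := si_ge0 S _ Dr.
  have h1 : tau * (c * b r r) <= tau * b r (U r).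
    apply: ler_wpM2l; first by rewrite /tau divr_ge0 ?ltW.
    by rewrite (siC S) // Uc.
  have h2 : tau ^+ 2 * b (U r) (U r) <= tau ^+ 2 * (L * b r r).
    apply: ler_wpM2l; first exact: sqr_ge0.
    apply: le_trans (UK _ Dr) _; apply: ler_wpM2r => //.
    by rewrite /L; have := ler_norm K; have := sqr_ge0 c; lra.
  have h3 : tau * c = c ^+ 2 / L by rewrite /tau; field; rewrite gt_eqF.
  have h4 : tau ^+ 2 * L = c ^+ 2 / L by rewrite /tau; field; rewrite gt_eqF.
  rewrite mulrA h3 in h1; rewrite mulrA h4 in h2; rewrite /th; lra.
have [n|F [DF [C' FP]]] := complete f (tau ^+ 2 * b (g - U (f 0%N)) (g - U (f 0%N))) t t01 Df.
  rewrite fE addrAC subrr add0r (siZl S) ?siZr //; last exact: (siZ S).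
  rewrite mulrA -expr2 exprM t4 -mulrA; apply: ler_wpM2l => //; exact: sqr_ge0.
have DUF := DU _ DF; exists F => //; apply/eqP; rewrite eq_le; apply/andP; split; last first.
  by apply: (si_ge0 S); apply: siB => //; exact: DU.
(* [U F - g] splits, for every n, into the image of the error [F - f n] and the n-th residual. Both
   squared norms are at most a constant times t^(2n), so the squared norm of [U F - g], which is
   independent of n, is at most 0. *)
set M := 2 * (`|K| * C') + 2 * b (g - U (f 0%N)) (g - U (f 0%N)).
have t2 : 0 < t ^+ 2 < 1.
  case/andP: t01 => ? ?; rewrite exprn_gt0 //= expr_lt1 //; exact: ltW.
apply: (le0_of_geometric _ _ M (t ^+ 2)) => // n.
have -> : U F - g = (U F - U (f n)) - (g - U (f n)).
  by rewrite opprB addrA subrK.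
have DUB := siB _ _ (DU _ DF) (DU _ (Df n)).
apply: le_trans (si_sqD_le _ _ DUB (siN _ (Drho n))) _.
have DFf := siB _ _ DF (Df n).
have -> : b (U F - U (f n)) (U F - U (f n)) = b (U (F - f n)) (U (F - f n)).
  apply: si_weak_eq => //; first exact: DU.
  move=> z Dz; have := UL (-1) F (f n) z DF (Df n) Dz.
  by rewrite rmorphN rmorph1 scaleN1r siBl // => ->; ring.
rewrite siNl //; last exact: siN.
rewrite (siC S) //; last exact: siN.
rewrite siNl // opprK.
have k1 : b (U (F - f n)) (U (F - f n)) <= `|K| * (C' * t ^+ (2 * n)).
  apply: le_trans (UK _ DFf) _; apply: le_trans (_ : `|K| * b (F - f n) (F - f n) <= _).
    by apply: ler_wpM2r; [exact: (si_ge0 S) | exact: ler_norm].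
  exact: ler_wpM2l.
have k2 : th ^+ n <= (t ^+ 2) ^+ n.
  rewrite -t4 -!exprM; apply: ler_wiXn2l; last by lia.
    by case/andP: t01 => /ltW.
  by case/andP: t01 => _ /ltW.
have k3 := ler_wpM2l (si_ge0 S _ (Drho 0%N)) k2.
have k4 := rho n.
by rewrite exprM in k1; rewrite /M; lra.
Qed.

End Operator.
End SemiInner.

Arguments geometrically_complete {R X} D b.

(** * The matrix-valued inner product *)

Section ComplexIntegral.
Context {R : realType} {G : topologicalZmodType}.
Context {mu : {measure set (Gborel G) -> \bar R}}.
Local Notation C := R[i].

Definition nsq (z : C) : R := complex.Re z ^+ 2 + complex.Im z ^+ 2.

Definition cintegrable (h : G -> C) : Prop :=
  mu.-integrable setT (EFin \o (fun x : Gborel G => complex.Re (h x))) /\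
  mu.-integrable setT (EFin \o (fun x : Gborel G => complex.Im (h x))).

(** Convertible to the clause of [isL2] for a single entry, so a proof of [isL2] applied to two
    indices can be used as a proof of it. *)
Definition square_integrable (h : G -> C) : Prop :=
  [/\ measurable_fun setT (fun x : Gborel G => complex.Re (h x)),
      measurable_fun setT (fun x : Gborel G => complex.Im (h x)) &
      mu.-integrable setT (fun x : Gborel G => (nsq (h x))%:E)].

Lemma integrable_le (h g : Gborel G -> R) : measurable_fun setT h ->
  (forall x, `|h x| <= g x) -> mu.-integrable setT (EFin \o g) ->
  mu.-integrable setT (EFin \o h).
Proof.
move=> mh hg; apply: le_integrable => //; first exact/measurable_EFinP.
by move=> x _; rewrite /= lee_fin (le_trans (hg x)) // ler_norm.
Qed.

Lemma integrable_realD (f g : Gborel G -> R) :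
  mu.-integrable setT (EFin \o f) -> mu.-integrable setT (EFin \o g) ->
  mu.-integrable setT (EFin \o (fun x => f x + g x)).
Proof.
move=> hf hg; have := integrableD (measurableT : measurable setT) hf hg.
by apply: eq_integrable => // x _ /=; rewrite EFinD.
Qed.

Lemma integrable_realZ (a : R) (f : Gborel G -> R) :
  mu.-integrable setT (EFin \o f) ->
  mu.-integrable setT (EFin \o (fun x => a * f x)).
Proof.
move=> hf; have := integrableZl (measurableT : measurable setT) a hf.
by apply: eq_integrable => // x _ /=; rewrite EFinM.
Qed.

Lemma cintegrableD u v : cintegrable u -> cintegrable v ->
  cintegrable (fun x => u x + v x).
Proof.
move=> [u1 u2] [v1 v2]; split.
  have := integrable_realD _ _ u1 v1; apply: eq_integrable => // x _ /=.
  by case: (u x) (v x) => ? ? [].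
have := integrable_realD _ _ u2 v2; apply: eq_integrable => // x _ /=.
by case: (u x) (v x) => ? ? [].
Qed.

Lemma cintegrableZ z u : cintegrable u -> cintegrable (fun x => z * u x).
Proof.
case: z => a c [u1 u2]; split.
  have := integrable_realD _ _ (integrable_realZ a _ u1) (integrable_realZ (- c) _ u2).
  by apply: eq_integrable => // x _ /=; case: (u x) => ? ? /=; rewrite mulNr.
have := integrable_realD _ _ (integrable_realZ a _ u2) (integrable_realZ c _ u1).
by apply: eq_integrable => // x _ /=; case: (u x) => ? ? /=.
Qed.

Lemma cintegralD u v : cintegrable u -> cintegrable v ->
  cintegral mu (fun x => u x + v x) = cintegral mu u + cintegral mu v.
Proof.
move=> [u1 u2] [v1 v2]; rewrite /cintegral.
transitivity (Complex (\int[mu]_x (complex.Re (u x) + complex.Re (v x)))%R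
  (\int[mu]_x (complex.Im (u x) + complex.Im (v x)))%R).
  by congr Complex; apply: eq_Rintegral => x _; case: (u x) (v x) => ? ? [].
by rewrite !RintegralD.
Qed.

Lemma cintegralZ z u : cintegrable u ->
  cintegral mu (fun x => z * u x) = z * cintegral mu u.
Proof.
case: z => a c [u1 u2]; rewrite /cintegral.
transitivity (Complex (\int[mu]_x (a * complex.Re (u x) - c * complex.Im (u x)))%R
  (\int[mu]_x (a * complex.Im (u x) + c * complex.Re (u x)))%R).
  by congr Complex; apply: eq_Rintegral => x _; case: (u x) => ? ?.
rewrite RintegralB ?RintegralD ?RintegralZl //; exact: integrable_realZ.
Qed.

Lemma cintegral0 : cintegral mu (fun=> 0) = 0.
Proof.
by have := cintegralZ 0 (fun=> 0); rewrite !mul0r; apply; split;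
  exact: (@integrable0 _ (Gborel G)).
Qed.

Lemma cintegrable_sum (I : Type) (s : seq I) (F : I -> G -> C) :
  (forall i, cintegrable (F i)) -> cintegrable (fun x => \sum_(i <- s) F i x).
Proof.
move=> hF; elim: s => [|i s IH].
  under eq_fun do rewrite big_nil.
  by split; exact: (@integrable0 _ (Gborel G)).
under eq_fun do rewrite big_cons; exact: cintegrableD.
Qed.

Lemma cintegral_sum (I : Type) (s : seq I) (F : I -> G -> C) :
  (forall i, cintegrable (F i)) ->
  cintegral mu (fun x => \sum_(i <- s) F i x) = \sum_(i <- s) cintegral mu (F i).
Proof.
move=> hF; elim: s => [|i s IH].
  by rewrite big_nil; under eq_fun do rewrite big_nil; exact: cintegral0.
under eq_fun do rewrite big_cons; rewrite cintegralD ?big_cons ?IH //.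
exact: cintegrable_sum.
Qed.

Lemma cintegral_conj u : cintegrable u ->
  cintegral mu (fun x => (u x)^*) = (cintegral mu u)^*.
Proof.
move=> [u1 u2]; rewrite /cintegral.
transitivity (Complex (\int[mu]_x (complex.Re (u x)))%R
  (\int[mu]_x (-1 * complex.Im (u x)))%R).
  by congr Complex; apply: eq_Rintegral => x _; case: (u x) => ? ? //=; rewrite mulN1r.
by rewrite RintegralZl // mulN1r.
Qed.

Lemma square_integrableD u v : square_integrable u -> square_integrable v ->
  square_integrable (fun x => u x + v x).
Proof.
move=> [u1 u2 u3] [v1 v2 v3].
have m1 : measurable_fun setT (fun x : Gborel G => complex.Re (u x + v x)).
  apply: eq_measurable_fun (measurable_funD u1 v1) => x _ /=.
  by case: (u x) (v x) => ? ? [].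
have m2 : measurable_fun setT (fun x : Gborel G => complex.Im (u x + v x)).
  apply: eq_measurable_fun (measurable_funD u2 v2) => x _ /=.
  by case: (u x) (v x) => ? ? [].
split=> //; apply: (integrable_le _ (fun x => 2 * nsq (u x) + 2 * nsq (v x))).
- by apply: measurable_funD; exact: measurable_funX.
- move=> x; rewrite ger0_norm ?addr_ge0 ?sqr_ge0 //.
  case: (u x) (v x) => a b [c d]; rewrite /nsq /=.
  have := sqr_ge0 (a - c); have := sqr_ge0 (b - d); nra.
- by apply: integrable_realD; exact: integrable_realZ.
Qed.

Lemma square_integrableZ z u : square_integrable u ->
  square_integrable (fun x => z * u x).
Proof.
case: z => a c [u1 u2 u3].
have m1 : measurable_fun setT (fun x : Gborel G => complex.Re ((a +i* c)%C * u x)).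
  apply: eq_measurable_fun (measurable_funB (measurable_funM (measurable_cst a) u1)
    (measurable_funM (measurable_cst c) u2)) => x _ /=.
  by case: (u x) => ? ?.
have m2 : measurable_fun setT (fun x : Gborel G => complex.Im ((a +i* c)%C * u x)).
  apply: eq_measurable_fun (measurable_funD (measurable_funM (measurable_cst a) u2)
    (measurable_funM (measurable_cst c) u1)) => x _ /=.
  by case: (u x) => ? ?.
split=> //; have := integrable_realZ (nsq (a +i* c)%C) _ u3.
apply: eq_integrable => // x _ /=; congr EFin.
by case: (u x) => p q; rewrite /nsq /=; ring.
Qed.

Lemma square_integrable0 : square_integrable (fun=> 0).
Proof.
by split; [exact: measurable_cst..|]; rewrite /nsq /= expr0n addr0;
  exact: (@integrable0 _ (Gborel G)).
Qed.

Lemma square_integrable_sum (I : Type) (s : seq I) (F : I -> G -> C) :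
  (forall i, square_integrable (F i)) ->
  square_integrable (fun x => \sum_(i <- s) F i x).
Proof.
move=> hF; elim: s => [|i s IH].
  under eq_fun do rewrite big_nil; exact: square_integrable0.
under eq_fun do rewrite big_cons; exact: square_integrableD.
Qed.

Lemma cintegrable_mul_conj u v : square_integrable u -> square_integrable v ->
  cintegrable (fun x => u x * (v x)^*).
Proof.
move=> [u1 u2 u3] [v1 v2 v3].
have i2 := integrable_realD _ _ u3 v3.
split; apply: (integrable_le _ _ _ _ i2).
- apply: eq_measurable_fun (measurable_funD (measurable_funM u1 v1) (measurable_funM u2 v2)) => x _ /=.
  by case: (u x) (v x) => a b [c d] /=; rewrite mulrN opprK.
- move=> x; case: (u x) (v x) => a b [c d]; rewrite /nsq /= ler_norml.
  have := sqr_ge0 (a - c); have := sqr_ge0 (b - d).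
  have := sqr_ge0 (a + c); have := sqr_ge0 (b + d); nra.
- apply: eq_measurable_fun (measurable_funB (measurable_funM u2 v1) (measurable_funM u1 v2)) => x _ /=.
  by case: (u x) (v x) => a b [c d] /=; ring.
- move=> x; case: (u x) (v x) => a b [c d]; rewrite /nsq /= ler_norml.
  have := sqr_ge0 (a - d); have := sqr_ge0 (b - c).
  have := sqr_ge0 (a + d); have := sqr_ge0 (b + c); nra.
Qed.

End ComplexIntegral.

Arguments cintegrable {R G} mu h.
Arguments square_integrable {R G} mu h.

(** * Sesquilinearity over matrices *)

Section MatrixInnerProduct.
Context {R : realType} {G : topologicalZmodType}.
Context {mu : {measure set (Gborel G) -> \bar R}}.
Context {s r : nat}.
Local Notation C := R[i].
Local Notation Mf := (G -> 'M[C]_(s, r)).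

Lemma ReD (x y : C) : complex.Re (x + y) = complex.Re x + complex.Re y.
Proof. by case: x y => ? ? []. Qed.

Lemma Re_sum (I : Type) (l : seq I) (F : I -> C) :
  complex.Re (\sum_(i <- l) F i) = \sum_(i <- l) complex.Re (F i).
Proof. exact: (big_morph _ ReD erefl). Qed.

Lemma isL2P (f : Mf) (u : 'I_s -> 'I_r -> G -> C) :
  (forall i j x, f x i j = u i j x) ->
  (forall i j, square_integrable mu (u i j)) -> isL2 mu f.
Proof.
move=> e h i j; have := h i j; rewrite (_ : u i j = (fun x => f x i j)) //.
by apply/funext => x; rewrite e.
Qed.

Lemma isL2D (f g : Mf) : isL2 mu f -> isL2 mu g -> isL2 mu (f + g).
Proof.
move=> hf hg; apply: isL2P => [i j x|i j]; first by rewrite mxE.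
exact: square_integrableD (hf i j) (hg i j).
Qed.

Lemma isL2_mulmx (A : 'M[C]_s) (f : Mf) :
  isL2 mu f -> isL2 mu (fun x => A *m f x).
Proof.
move=> hf; apply: isL2P => [i j x|i j]; first by rewrite mxE.
by apply: square_integrable_sum => k; apply: square_integrableZ; exact: hf.
Qed.

Lemma isL2Z (a : C) (f : Mf) : isL2 mu f -> isL2 mu (a *: f).
Proof.
move=> hf; apply: isL2P => [i j x|i j]; first by rewrite mxE.
by apply: square_integrableZ; exact: hf.
Qed.

Lemma isL2_0 : isL2 mu (0 : Mf).
Proof.
apply: (@isL2P _ (fun _ _ _ => 0)) => [i j x|i j]; first by rewrite mxE.
exact: square_integrable0.
Qed.

Lemma isL2_sum (I : Type) (l : seq I) (F : I -> Mf) :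
  (forall i, isL2 mu (F i)) -> isL2 mu (fun x => \sum_(i <- l) F i x).
Proof.
move=> hF; elim: l => [|i l IH].
  under eq_fun do rewrite big_nil; exact: isL2_0.
under eq_fun do rewrite big_cons; exact: isL2D.
Qed.

(** This and the next two lemmas open one layer of entries and keep the [mip] terms inside folded,
    ready for [mip_entryE]. *)
Lemma addmx_entry (A B : 'M[C]_s) i j : (A + B) i j = A i j + B i j.
Proof. by rewrite mxE. Qed.

Lemma mulmx_entry (A B : 'M[C]_s) i j : (A *m B) i j = \sum_k A i k * B k j.
Proof. by rewrite mxE. Qed.

Lemma adjmx_entry p q (A : 'M[C]_(p, q)) i j : adjmx A i j = (A j i)^*.
Proof. by rewrite !mxE. Qed.

Lemma mip_entryE (f g : Mf) i j :
  mip mu f g i j = cintegral mu (fun x => \sum_k f x i k * (g x j k)^*).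
Proof.
rewrite mxE; congr cintegral; apply/funext => x; rewrite mxE.
by apply: eq_bigr => k _; rewrite !mxE.
Qed.

Lemma mip_integrable (f g : Mf) i j : isL2 mu f -> isL2 mu g ->
  cintegrable mu (fun x => \sum_k f x i k * (g x j k)^*).
Proof.
move=> hf hg; apply: cintegrable_sum => k.
exact: cintegrable_mul_conj (hf i k) (hg j k).
Qed.

Lemma mipDl (f g h : Mf) : isL2 mu f -> isL2 mu g -> isL2 mu h ->
  mip mu (f + g) h = mip mu f h + mip mu g h.
Proof.
move=> hf hg hh; apply/matrixP => i j.
apply: etrans (mip_entryE _ _ _ _) _; apply: esym.
apply: etrans (addmx_entry _ _ _ _) _.
apply: etrans (congr2 +%R (mip_entryE _ _ _ _) (mip_entryE _ _ _ _)) _; apply: esym.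
rewrite -cintegralD; [|exact: (mip_integrable f h)|exact: (mip_integrable g h)].
congr cintegral; apply/funext => x; rewrite -big_split /=.
by apply: eq_bigr => k _; rewrite mxE mulrDl.
Qed.

Lemma mip_mulmxl (A : 'M[C]_s) (f g : Mf) : isL2 mu f -> isL2 mu g ->
  mip mu (fun x => A *m f x) g = A *m mip mu f g.
Proof.
move=> hf hg; apply/matrixP => i j.
apply: etrans (mip_entryE _ _ _ _) _; apply: esym.
apply: etrans (mulmx_entry _ _ _ _) _; apply: esym.
transitivity (\sum_k cintegral mu (fun x => A i k * \sum_l f x k l * (g x j l)^*)); last first.
  apply: eq_bigr => k _; apply: etrans (cintegralZ _ _ (mip_integrable _ _ _ _ hf hg)) _.
  exact: congr1 _ (esym (mip_entryE _ _ _ _)).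
rewrite -cintegral_sum; last first.
  by move=> k; apply: cintegrableZ; exact: (mip_integrable f g).
congr cintegral; apply/funext => x.
under eq_bigr => k _ do rewrite mxE mulr_suml.
rewrite exchange_big /=; apply: eq_bigr => k _.
by rewrite mulr_sumr; apply: eq_bigr => l _; rewrite mulrA.
Qed.

Lemma mip_adj (f g : Mf) : isL2 mu f -> isL2 mu g ->
  mip mu g f = adjmx (mip mu f g).
Proof.
move=> hf hg; apply/matrixP => i j; apply: etrans (mip_entryE _ _ _ _) _; apply: esym.
apply: etrans (adjmx_entry _ _ _ _ _) _; apply: etrans (congr1 _ (mip_entryE _ _ _ _)) _.
apply: esym.
rewrite -cintegral_conj; last exact: (mip_integrable f g).
congr cintegral; apply/funext => x; rewrite rmorph_sum.
by apply: eq_bigr => k _; rewrite rmorphM /= mulrC conjCK.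
Qed.

Lemma nrm2E (f : Mf) : isL2 mu f ->
  nrm2 mu f = (\int[mu]_x (\sum_i \sum_k nsq (f x i k)))%R.
Proof.
move=> hf; rewrite /nrm2 /ipL2 /mxtrace.
under eq_bigr => i _ do rewrite mip_entryE.
rewrite -cintegral_sum; last by move=> i; exact: mip_integrable.
rewrite /cintegral /=; apply: eq_Rintegral => x _; rewrite Re_sum.
apply: eq_bigr => i _; rewrite Re_sum; apply: eq_bigr => k _.
by case: (f x i k) => a b; rewrite /nsq /= mulrN opprK !expr2.
Qed.

Definition re_ip (f g : Mf) : R := complex.Re (ipL2 mu f g).

End MatrixInnerProduct.

Arguments re_ip {R G} mu {s r} f g.

(** * The real trace form and its null vectors *)

Section RealInnerProduct.
Context {R : realType} {G : topologicalZmodType}.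
Context {mu : {measure set (Gborel G) -> \bar R}}.
Context {s r : nat}.
Local Notation C := R[i].
Local Notation Mf := (G -> 'M[C]_(s, r)).
Local Notation rip := (@re_ip R G mu s r).
Local Notation L2 := (@isL2 R G mu s r).

Lemma mxtrace_adjmx (A : 'M[C]_s) : \tr (adjmx A) = (\tr A)^*.
Proof. by rewrite /mxtrace rmorph_sum; apply: eq_bigr => i _; rewrite adjmx_entry. Qed.

Lemma adjmxM (A B : 'M[C]_s) : adjmx (A *m B) = adjmx B *m adjmx A.
Proof.
apply/matrixP => i j; rewrite adjmx_entry !mulmx_entry rmorph_sum.
by apply: eq_bigr => k _; rewrite !adjmx_entry rmorphM mulrC.
Qed.

Lemma mip_mulmxr (A : 'M[C]_s) (f g : Mf) : L2 f -> L2 g ->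
  mip mu f (fun x => A *m g x) = mip mu f g *m adjmx A.
Proof.
move=> hf hg; have hAg := isL2_mulmx A _ hg.
apply: etrans (mip_adj _ _ hAg hf) _.
apply: etrans (congr1 _ (mip_mulmxl A _ _ hg hf)) _.
apply: etrans (adjmxM _ _) _; congr (_ *m _).
exact: esym (mip_adj _ _ hg hf).
Qed.

Lemma rip_semi_inner : semi_inner L2 rip.
Proof.
split.
- exact: isL2_0.
- exact: isL2D.
- by move=> a f; exact: isL2Z.
- move=> f g hf hg; rewrite /re_ip /ipL2.
  transitivity (complex.Re (\tr (adjmx (mip mu g f)))).
    by congr (complex.Re (\tr _)); exact: mip_adj _ _ hg hf.
  by rewrite mxtrace_adjmx; case: (\tr _).
- move=> f g h hf hg hh; rewrite /re_ip /ipL2 -ReD -mxtraceD.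
  by congr (complex.Re (\tr _)); exact: mipDl _ _ _ hf hg hh.
- move=> a f g hf hg; rewrite /re_ip /ipL2.
  have -> : a%:C *: f = (fun x => a%:C%:M *m f x).
    by apply/funext => x; rewrite mul_scalar_mx.
  transitivity (complex.Re (\tr (a%:C%:M *m mip mu f g))).
    by congr (complex.Re (\tr _)); exact: mip_mulmxl _ _ _ hf hg.
  by rewrite mul_scalar_mx mxtraceZ; case: (\tr _) => ? ? /=; rewrite mul0r subr0.
- move=> f hf; rewrite -[re_ip _ _ _]/(nrm2 mu f) nrm2E //.
  apply: Rintegral_ge0 => x _; apply: sumr_ge0 => i _; apply: sumr_ge0 => k _.
  by rewrite addr_ge0 ?sqr_ge0.
Qed.

(** The scalar form controls the whole matrix: with P = <f, g>, testing [f] against P g gives the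
    trace of P times its adjoint, which is the sum of the squared moduli of the entries of P.
    Cauchy-Schwarz makes it 0. *)
Lemma mip_null (f g : Mf) : L2 f -> L2 g -> rip f f = 0 -> mip mu f g = 0.
Proof.
move=> hf hg f0; set P := mip mu f g.
have := si_null rip_semi_inner f (fun x => P *m g x) hf (isL2_mulmx P _ hg) f0.
rewrite /re_ip /ipL2.
have -> : mip mu f (fun x => P *m g x) = P *m adjmx P by exact: mip_mulmxr.
rewrite /mxtrace Re_sum.
have e i : complex.Re ((P *m adjmx P) i i) = \sum_k nsq (P i k).
  rewrite mulmx_entry Re_sum; apply: eq_bigr => k _; rewrite adjmx_entry.
  by case: (P i k) => a b; rewrite /nsq /= mulrN opprK !expr2.
move=> h0; have {h0} : \sum_i \sum_k nsq (P i k) = 0.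
  by apply: etrans h0; apply: eq_bigr => i _; exact: esym (e i).
move=> /eqP; rewrite psumr_eq0; last first.
  by move=> i _; apply: sumr_ge0 => k _; rewrite addr_ge0 ?sqr_ge0.
move=> /allP h; apply/matrixP => i j; rewrite [RHS]mxE.
have := h i (mem_index_enum _); rewrite /= psumr_eq0; last first.
  by move=> k _; rewrite addr_ge0 ?sqr_ge0.
move=> /allP /(_ j (mem_index_enum _)) /=; rewrite /nsq paddr_eq0 ?sqr_ge0 // !sqrf_eq0.
by case: (P i j) => a b /= /andP[/eqP -> /eqP ->].
Qed.

(** Links the two levels of the definitions: [eqL2] speaks of a trace norm, adjointability of
    matrix-valued products. *)
Lemma eqL2_mip (f g h : Mf) : L2 f -> L2 g -> L2 h -> eqL2 mu f g ->
  mip mu f h = mip mu g h.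
Proof.
move=> hf hg hh fg; have hfg : L2 (f - g) := siB rip_semi_inner _ _ hf hg.
have z := mip_null _ _ hfg hh fg.
have : mip mu (f - g + g) h = mip mu (f - g) h + mip mu g h by exact: mipDl.
by rewrite subrK z add0r.
Qed.

Lemma mip_suml (n : nat) (A : nat -> 'M[C]_s) (F : nat -> Mf) (g : Mf) :
  (forall k, L2 (F k)) -> L2 g ->
  mip mu (fun x => \sum_(k < n) A k *m F k x) g = \sum_(k < n) A k *m mip mu (F k) g.
Proof.
move=> hF hg; elim: n => [|n IH].
  rewrite big_ord0.
  have e : (fun x => \sum_(k < 0) A k *m F k x) = (fun x => 0%:M *m g x).
    by apply/funext => x; rewrite big_ord0 mul_scalar_mx scale0r.
  apply: etrans (congr1 (fun f => mip mu f g) e) _.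
  by apply: etrans (mip_mulmxl _ _ _ hg hg) _; rewrite mul_scalar_mx scale0r.
have e : (fun x => \sum_(k < n.+1) A k *m F k x) =
   (fun x => \sum_(k < n) A k *m F k x) + (fun x => A n *m F n x).
  by apply/funext => x; rewrite big_ord_recr.
apply: etrans (congr1 (fun f => mip mu f g) e) _.
have h1 : L2 (fun x => \sum_(k < n) A k *m F k x).
  by apply: (isL2_sum _ _ (fun (k : 'I_n) x => A k *m F k x)) => k; exact: isL2_mulmx.
have h2 := isL2_mulmx (A n) _ (hF n).
rewrite big_ord_recr /=; apply: etrans (mipDl _ _ _ h1 h2 hg) _.
by apply: congr2 => //; exact: mip_mulmxl.
Qed.

End RealInnerProduct.

(** * Completeness *)

Lemma geometric_increments (R : realType) (a : nat -> R) (M t : R) :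
  0 < t < 1 -> (forall n, `|a n.+1 - a n| <= M * t ^+ n) ->
  cvgn a /\ forall n, `|limn a - a n| <= M / (1 - t) * t ^+ n.
Proof.
move=> /andP[t0 t1] ha; have tn : `|t| < 1 by rewrite gtr0_norm.
have M0 : 0 <= M by have := ha 0%N; rewrite mulr1; exact: le_trans.
have ca : cvgn a.
  have cs : cvgn (series (telescope a)).
    apply: normed_cvg; apply: (@series_le_cvg _ _ (geometric M t)) => [n|n|n|].
    - exact: normr_ge0.
    - by rewrite /= mulr_ge0 // exprn_ge0 // ltW.
    - exact: ha.
    - exact: is_cvg_geometric_series.
  rewrite (_ : a = (fun n => a 0%N + series (telescope a) n)); last first.
    by apply/funext => n; exact: eq_sum_telescope.
  by apply: is_cvgD => //; exact: is_cvg_cst.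
split=> // n.
(* The right side is the exact sum of M t^k over n <= k < n + m, which lets the induction close. *)
have step m : `|a (n + m)%N - a n| <= M / (1 - t) * (t ^+ n - t ^+ (n + m)).
  have t1' : 0 < 1 - t by rewrite subr_gt0.
  elim: m => [|m IH]; first by rewrite addn0 !subrr normr0 mulr0.
  rewrite addnS -(subrKA (a (n + m)%N)) (le_trans (ler_normD _ _)) //.
  apply: le_trans (lerD (ha _) IH) _.
  rewrite (exprS t (n + m)) le_eqVlt; apply/orP; left; apply/eqP.
  by field; rewrite gt_eqF.
have cn : (fun m => `|a m - a n|) @ \oo --> `|limn a - a n|.
  by apply: cvg_norm; apply: cvgB => //; exact: cvg_cst.
rewrite -(cvg_lim (@Rhausdorff R) cn); apply: limr_le; first by apply/cvg_ex; exists (`|limn a - a n|).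
exists n => // m /= nm; rewrite -(subnKC nm); apply: le_trans (step _) _.
apply: ler_wpM2l; first by rewrite divr_ge0 // subr_ge0 ltW.
by rewrite gerBl exprn_ge0 // ltW.
Qed.

Section Completeness.
Context {R : realType} {G : topologicalZmodType}.
Context {mu : {measure set (Gborel G) -> \bar R}}.
Context {s r : nat}.
Local Notation C := R[i].
Local Notation Mf := (G -> 'M[C]_(s, r)).
Local Notation rip := (@re_ip R G mu s r).
Local Notation L2 := (@isL2 R G mu s r).

Lemma measurable_geometric_limit (t : R) (W : Gborel G -> \bar R)
    (a : nat -> Gborel G -> R) :
  0 < t < 1 -> measurable_fun setT W ->
  (forall n, measurable_fun setT (a n)) ->
  (forall n x, (W x < +oo)%E ->
     (a n.+1 x - a n x) ^+ 2 <= fine (W x) * (t ^+ 2) ^+ n) ->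
  exists f : Gborel G -> R, measurable_fun setT f /\
    forall n x, (W x < +oo)%E ->
      (f x - a n x) ^+ 2 <= fine (W x) / (1 - t) ^+ 2 * (t ^+ 2) ^+ n.
Proof.
move=> t01 mW ma ha; have /andP[t0 t1] := t01.
(* Setting the sequence to 0 where [W] is infinite makes it converge at every point, so its limit is
   measurable on all of [G]. *)
pose b n x := if (W x < +oo)%E then a n x else 0.
have W0 x : (W x < +oo)%E -> 0 <= fine (W x).
  by move=> /(ha 0%N); rewrite mulr1; apply: le_trans; exact: sqr_ge0.
have sq (u v : R) n : 0 <= u -> (v ^+ 2 <= u * (t ^+ 2) ^+ n) = (`|v| <= Num.sqrt u * t ^+ n).
  move=> u0; rewrite -[v ^+ 2]real_normK ?num_real // -exprM mulnC exprM -{1}(sqr_sqrtr u0) -exprMn.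
  by rewrite ler_pXn2r // nnegrE // mulr_ge0 ?sqrtr_ge0 // exprn_ge0 // ltW.
have hb x : cvgn (b ^~ x) /\ forall n, `|limn (b ^~ x) - b n x| <=
    (if (W x < +oo)%E then Num.sqrt (fine (W x)) else 0) / (1 - t) * t ^+ n.
  apply: geometric_increments => // n; rewrite /b; case: ifPn => Wx.
    by rewrite -sq ?ha //; exact: W0.
  by rewrite subrr normr0 mul0r.
exists (fun x => limn (b ^~ x)); split.
  apply: (@measurable_fun_cvg _ _ _ _ b) => [m|x _]; last by have [] := hb x.
  apply: measurable_fun_ifT => //.
  by apply: measurable_fun_lte => //; exact: measurable_cst.
move=> n x Wx; have [_ /(_ n)] := hb x; rewrite /b Wx => h.
have d0 : 0 < 1 - t by rewrite subr_gt0.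
rewrite sq; last by rewrite divr_ge0 ?sqr_ge0 //; exact: W0.
have -> : Num.sqrt (fine (W x) / (1 - t) ^+ 2) = Num.sqrt (fine (W x)) / (1 - t).
  by rewrite sqrtrM ?W0 // sqrtrV ?sqr_ge0 // sqrtr_sqr gtr0_norm.
by [].
Qed.

(* With [w k] the pointwise squared norm of the k-th increment, [W = sum_k t^(-2k) w k]
   is integrable and dominates all increments geometrically wherever it is finite. *)
Lemma rip_complete : geometrically_complete L2 rip.
Proof.
move=> S K t t01 hS hd; have /andP[t0 t1] := t01.
have Bin := @rip_semi_inner R G mu s r.
pose d k : Mf := S k.+1 - S k.
have dL2 k : L2 (d k) by exact: (siB Bin _ _ (hS k.+1) (hS k)).
pose w k (x : Gborel G) : R := \sum_i \sum_j nsq (d k x i j).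
have nsq0 (z : C) : 0 <= nsq z by rewrite addr_ge0 ?sqr_ge0.
have w0 k x : 0 <= w k x by apply: sumr_ge0 => i _; apply: sumr_ge0.
have nsqw k x i j : nsq (d k x i j) <= w k x.
  rewrite /w (bigD1 i) //= (bigD1 j) //= -addrA lerDl addr_ge0 ?sumr_ge0 //.
  by move=> i' _; apply: sumr_ge0.
have int_nsq (f : Mf) : L2 f -> mu.-integrable setT (EFin \o (fun x : Gborel G => \sum_i \sum_j nsq (f x i j))).
  move=> hf.
  have hi i : mu.-integrable setT (fun x : Gborel G => (\sum_j (nsq (f x i j))%:E)%E).
    by apply: (integrable_sum measurableT (index_enum 'I_r)) => j _; have [] := hf i j.
  have := integrable_sum measurableT (index_enum 'I_s) (fun i (_ : xpredT i) => hi i).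
  apply: eq_integrable => // x _ /=; rewrite -sumEFin.
  by apply: eq_bigr => i _; rewrite -sumEFin.
have wint k : mu.-integrable setT (EFin \o w k) by exact: int_nsq.
have wnrm k : (\int[mu]_x (w k x)%:E)%E = (rip (d k) (d k))%:E.
  rewrite -[re_ip _ _ _]/(nrm2 mu (d k)) nrm2E // /Rintegral fineK //.
  by apply: integrable_fin_num => //; exact: wint.
have t2 k : 0 < (t ^+ 2) ^+ k by rewrite !exprn_gt0.
pose v k (x : Gborel G) : \bar R := (((t ^+ 2) ^+ k)^-1 * w k x)%:E.
have v0 k x : (0 <= v k x)%E by rewrite lee_fin mulr_ge0 ?invr_ge0 ?w0 // ltW.
have vint k : mu.-integrable setT (v k) by apply: integrable_realZ; exact: wint.
have mv k : measurable_fun setT (v k) by have /integrableP[] := vint k.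
pose W x := (\sum_(0 <= k <oo) v k x)%E.
have W0 x : (0 <= W x)%E by apply: nneseries_ge0.
have mW : measurable_fun setT W by apply: ge0_emeasurable_sum => *; [exact: v0|exact: mv].
have K0 : 0 <= K.
  by have := le_trans (si_ge0 Bin _ (dL2 0%N)) (hd 0%N); rewrite mulr1.
(* [w k] integrates to at most K t^(4k); the weight t^(-2k) leaves a geometric series of ratio
   t^2. *)
have iW : (\int[mu]_x W x < +oo)%E.
  rewrite integral_nneseries //.
  apply: (@le_lt_trans _ _ (K / (1 - t ^+ 2))%:E); last exact: ltry.
  apply: lime_le; first by apply: is_cvg_nneseries => k _ _; exact: integral_ge0.
  apply: nearW => n.
  apply: (@le_trans _ _ (series (geometric K (t ^+ 2)) n)%:E).
    rewrite /series /= -sumEFin; apply: lee_sum => k _.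
    rewrite /v; under eq_integral do rewrite EFinM.
    rewrite integralZl //; last exact: wint.
    rewrite wnrm -EFinM lee_fin ler_pdivrMl //; apply: le_trans (hd k) _.
    by rewrite mulrCA -exprD -exprM (_ : (2 * (k + k) = 4 * k)%N) //; lia.
  rewrite lee_fin; apply: geometric_le_lim => //; first by rewrite exprn_gt0.
  by rewrite ger0_norm ?expr_lt1 // ?exprn_ge0 // ltW.
have WI : mu.-integrable setT W.
  apply/integrableP; split => //.
  by under eq_integral do rewrite gee0_abs //.
have wW k x : (W x < +oo)%E -> w k x <= fine (W x) * (t ^+ 2) ^+ k.
  move=> Wx; rewrite mulrC -ler_pdivrMl // -lee_fin fineK ?ge0_fin_numE //.
  apply: le_trans (nneseries_lim_ge k.+1 _) => //.
  by rewrite big_nat_recr //= leeDr // sume_ge0.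
have comp i j : exists f : (Gborel G -> R) * (Gborel G -> R),
  [/\ measurable_fun setT f.1, measurable_fun setT f.2 &
   forall n x, (W x < +oo)%E ->
    (f.1 x - complex.Re (S n x i j)) ^+ 2 + (f.2 x - complex.Im (S n x i j)) ^+ 2
      <= 2 * (fine (W x) / (1 - t) ^+ 2 * (t ^+ 2) ^+ n)].
  have dE n x : d n x i j = S n.+1 x i j - S n x i j by rewrite !mxE.
  have [||f1 [m1 h1]] := @measurable_geometric_limit t W (fun n x => complex.Re (S n x i j)) t01 mW.
  - by move=> n; have [] := hS n i j.
  - move=> n x Wx; apply: le_trans (wW n x Wx); apply: le_trans (nsqw n x i j).
    rewrite dE /nsq; case: (S n.+1 x i j) (S n x i j) => p q [p' q'] /=.
    by rewrite lerDl sqr_ge0.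
  have [||f2 [m2 h2]] := @measurable_geometric_limit t W (fun n x => complex.Im (S n x i j)) t01 mW.
  - by move=> n; have [] := hS n i j.
  - move=> n x Wx; apply: le_trans (wW n x Wx); apply: le_trans (nsqw n x i j).
    rewrite dE /nsq; case: (S n.+1 x i j) (S n x i j) => p q [p' q'] /=.
    by rewrite lerDr sqr_ge0.
  exists (f1, f2); split => //= n x Wx.
  by have := h1 n x Wx; have := h2 n x Wx; lra.
have [F FP] := choice (fun p => comp p.1 p.2).
pose f : Mf := fun x => \matrix_(i, j) Complex ((F (i, j)).1 x) ((F (i, j)).2 x).
(* The added 1 keeps [c] positive even for empty index sets. Where [W x] is infinite, a zero
   coefficient would turn the bound into 0. *)
pose c : R := \sum_(i < s) \sum_(j < r) (2 / (1 - t) ^+ 2) + 1.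
have c0 : 0 < c.
  rewrite ltr_wpDl // sumr_ge0 // => i _; rewrite sumr_ge0 // => j _.
  by rewrite divr_ge0 // sqr_ge0.
(* Where [W x] is infinite the right side is infinite as well, so the inequality holds at every
   point and can be integrated directly. *)
have fW n x : ((\sum_i \sum_j nsq ((f - S n) x i j))%:E <= (c * (t ^+ 2) ^+ n)%:E * W x)%E.
  have [Wx|] := boolP (W x < +oo)%E; last first.
    rewrite -leNgt leye_eq => /eqP ->; rewrite gt0_muley ?leey // lte_fin mulr_gt0 //.
  rewrite -[W x]fineK ?ge0_fin_numE // -EFinM lee_fin.
  apply: (@le_trans _ _ (\sum_(i < s) \sum_(j < r) 2 * (fine (W x) / (1 - t) ^+ 2 * (t ^+ 2) ^+ n))).
    apply: ler_sum => i _; apply: ler_sum => j _.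
    have [_ _ /(_ n x Wx)] := FP (i, j); rewrite /f /nsq !mxE.
    by case: (S n x i j) => p q /=.
  apply: (@le_trans _ _ ((\sum_(i < s) \sum_(j < r) (2 / (1 - t) ^+ 2)) * (t ^+ 2) ^+ n * fine (W x))); last first.
    by rewrite -!mulrA ler_wpM2r ?lerDl // mulr_ge0 ?(ltW (t2 _)) // fine_ge0.
  rewrite !mulr_suml; apply: ler_sum => i _; apply: ler_sum => j _.
  by rewrite le_eqVlt; apply/orP; left; apply/eqP; ring.
have cWI n : mu.-integrable setT (fun x => (c * (t ^+ 2) ^+ n)%:E * W x)%E.
  exact: integrableZl.
(* Domination by [W] applies to differences, so square integrability of [f] is reached through
   [f - S 0]. *)
have fS0 : L2 (f - S 0%N).
  move=> i j; have [h1 h2 _] := hS 0%N i j; have [m1 m2 _] := FP (i, j).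
  have e1 x : complex.Re ((f - S 0%N) x i j) = (F (i, j)).1 x - complex.Re (S 0%N x i j).
    by rewrite !mxE; case: (S 0%N x i j).
  have e2 x : complex.Im ((f - S 0%N) x i j) = (F (i, j)).2 x - complex.Im (S 0%N x i j).
    by rewrite !mxE; case: (S 0%N x i j).
  have m1' : measurable_fun setT (fun x : Gborel G => complex.Re ((f - S 0%N) x i j)).
    by under eq_fun do rewrite e1; exact: measurable_funB.
  have m2' : measurable_fun setT (fun x : Gborel G => complex.Im ((f - S 0%N) x i j)).
    by under eq_fun do rewrite e2; exact: measurable_funB.
  split => //; apply: le_integrable (cWI 0%N) => //.
    by apply/measurable_EFinP; apply: measurable_funD; exact: measurable_funX.
  move=> x _; rewrite !gee0_abs ?mule_ge0 ?lee_fin ?addr_ge0 ?sqr_ge0 ?mulr_ge0 ?(ltW c0) ?(ltW (t2 _)) //.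
  apply: le_trans (fW 0%N x); rewrite lee_fin (bigD1 i) //= (bigD1 j) //= -addrA lerDl.
  by rewrite addr_ge0 ?sumr_ge0 // => i' _; apply: sumr_ge0.
have fL2 : L2 f.
  by rewrite -(subrK (S 0%N) f); exact: isL2D.
exists f; split => //; exists (c * fine (\int[mu]_x W x)%E) => n.
have fSn := siB Bin _ _ fL2 (hS n).
rewrite -[re_ip _ _ _]/(nrm2 mu (f - S n)) nrm2E // -lee_fin.
rewrite /Rintegral fineK; last by apply: integrable_fin_num => //; exact: int_nsq.
rewrite exprM mulrAC EFinM fineK; last by apply: integrable_fin_num.
rewrite -ge0_integralZl //; last by rewrite lee_fin mulr_ge0 ?ltW.
apply: ge0_le_integral => //.
- by move=> x _; rewrite lee_fin; apply: sumr_ge0 => i _; apply: sumr_ge0.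
- by have /integrableP[] := int_nsq _ fSn.
- by have /integrableP[] := cWI n.
Qed.

End Completeness.

(** * Domination by the quadratic form of a Riesz operator *)

Section RieszDomination.
Context {R : realType} {G : topologicalZmodType}.
Context {mu : {measure set (Gborel G) -> \bar R}}.
Context {s r : nat}.
Local Notation C := R[i].
Local Notation Mf := (G -> 'M[C]_(s, r)).
Local Notation rip := (@re_ip R G mu s r).
Local Notation L2 := (@isL2 R G mu s r).

Let Bin := @rip_semi_inner R G mu s r.

Lemma eq_mip_rip (f g f' g' : Mf) : mip mu f g = mip mu f' g' ->
  rip f g = rip f' g'.
Proof.
have H (P Q : 'M[C]_s) : P = Q -> complex.Re (\tr P) = complex.Re (\tr Q).
  by move=> ->.
exact: (H (mip mu f g) (mip mu f' g')).
Qed.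

Lemma eqL2_rip (f g h : Mf) : L2 f -> L2 g -> L2 h -> eqL2 mu f g ->
  rip f h = rip g h.
Proof.
move=> hf hg hh fg; apply: eq_mip_rip; exact: (eqL2_mip _ _ _ hf hg hh fg).
Qed.

Lemma linear_rip (U : Mf -> Mf) : preservesL2 mu U -> linearL2 mu U ->
  forall (a : R) f g h, L2 f -> L2 g -> L2 h ->
  rip (U (f + a%:C *: g)) h = rip (U f) h + a * rip (U g) h.
Proof.
move=> pU lU a f g h hf hg hh.
have hag := siZ Bin a _ hg; have hfg := siD Bin _ _ hf hag.
have hUag := siZ Bin a _ (pU _ hg).
have := lU 1 a%:C f g hf hg.
have -> : (fun x => 1 *: f x + a%:C *: g x) = f + a%:C *: g.
  by apply/funext => x; rewrite scale1r.
have -> : (fun x => 1 *: U f x + a%:C *: U g x) = U f + a%:C *: U g.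
  by apply/funext => x; rewrite scale1r.
move=> e; apply: etrans (eqL2_rip _ _ _ (pU _ hfg) _ hh e) _.
  exact: (siD Bin _ _ (pU _ hf) hUag).
apply: etrans (siDl Bin _ _ _ (pU _ hf) hUag hh) _.
by congr (_ + _); exact: (siZl Bin _ _ _ (pU _ hg) hh).
Qed.

Lemma linear_ripB (U : Mf -> Mf) : preservesL2 mu U -> linearL2 mu U ->
  forall f g h, L2 f -> L2 g -> L2 h ->
  rip (U (f - g)) h = rip (U f) h - rip (U g) h.
Proof.
move=> pU lU f g h hf hg hh; have := linear_rip U pU lU (-1) f g h hf hg hh.
by rewrite rmorphN rmorph1 scaleN1r mulN1r.
Qed.

Lemma selfadjoint_rip (U : Mf -> Mf) : selfadjointL2 mu U ->
  forall f g, L2 f -> L2 g -> rip (U f) g = rip f (U g).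
Proof. by move=> sU f g hf hg; exact: (f_equal (@complex.Re R) (sU f g hf hg)). Qed.

Lemma positive_rip (U : Mf -> Mf) : positiveL2 mu U ->
  forall f, L2 f -> 0 <= rip (U f) f.
Proof. by move=> [_ _ pU] f hf; have := pU f hf; rewrite lecE => /andP[]. Qed.

Lemma positive_form (U : Mf -> Mf) : positiveL2 mu U ->
  semi_inner L2 (fun f g => rip (U f) g).
Proof.
move=> pU; have [[hU lU _] sU _] := pU.
exact: (operator_form Bin U hU (linear_rip U hU lU) (selfadjoint_rip U sU) (positive_rip U pU)).
Qed.

Definition expansion (A : nat -> 'M[C]_s) (F : nat -> Mf) (n : nat) : Mf :=
  fun x => \sum_(k < n) A k *m F k x.

Lemma expansionL2 A F n : (forall k, L2 (F k)) -> L2 (expansion A F n).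
Proof.
move=> hF; apply: (isL2_sum _ _ (fun (k : 'I_n) x => A k *m F k x)) => k.
exact: isL2_mulmx.
Qed.

(** The right side sees [F] only through its Gram matrices, so equal coefficients over two
    orthonormal families give equal norms. *)
Lemma expansion_gram A F n : (forall k, L2 (F k)) ->
  mip mu (expansion A F n) (expansion A F n) =
  \sum_(k < n) A k *m adjmx (\sum_(j < n) A j *m mip mu (F j) (F k)).
Proof.
move=> hF; apply: etrans (mip_suml _ _ _ _ hF (expansionL2 _ _ _ hF)) _.
apply: eq_bigr => k _; congr (_ *m _).
apply: etrans (mip_adj _ _ (expansionL2 _ _ _ hF) (hF k)) _.
by congr adjmx; exact: mip_suml.
Qed.

(* If [g = V h] and [S n], [F n] are the partial expansions with the coefficients of
   [h] in [E'] and [E], then [T (F n)] and [V (S n)] have the same inner products and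
   [F n] stays bounded, so Cauchy-Schwarz for the form of [T] applies; boundedness of
   the inverse of [V] is not needed. *)
Lemma riesz_dominated (T : Mf -> Mf) (E : nat -> Mf) :
  positiveL2 mu T -> adjointable mu T -> mv_onb mu E ->
  mv_riesz mu (fun k => T (E k)) ->
  forall g, L2 g -> exists K : R, forall x, L2 x ->
    rip g x ^+ 2 <= K * rip (T x) x.
Proof.
(* The arithmetic of [bound], isolated over plain real variables; [sq_le] rests on (u + v)^2 <= 2
   u^2 + 2 v^2. *)
have split_by (p p' u v w : R) : p = p' -> u = v -> w = u - p' -> v = w + p by lra.
have form_le (p u v w : R) : 2 * p <= u + v -> u <= w * v -> 0 <= v -> 0 <= w ->
    p <= (w + 1) * v.
  by move=> h1 h2 v0 w0; have := mulr_ge0 w0 v0; lra.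
have sq_le (p u v m k a d e q : R) : p = u + v -> u ^+ 2 <= k * d * e ->
    v ^+ 2 <= m * (2 * a + 2 * d) * q ->
    p ^+ 2 <= 4 * m * a * q + (4 * m * q + 2 * k * e) * d.
  by move=> ->; have := sqr_ge0 (u - v); lra.
move=> pT [T' [hT' aT]] [hE gE _] [E' [V [[hE' gE' cE'] [hV lV [KV bV]] [_ sV] [V' [hV' aV]] eTV]]] g hg.
have [[hT _ [KT bT]] _ _] := pT; have Tin := positive_form _ pT.
have [h hh gh] := sV g hg.
pose A k := mip mu h (E' k).
pose S n := expansion A E' n; pose F n := expansion A E n.
have hS n : L2 (S n) by exact: expansionL2.
have hF n : L2 (F n) by exact: expansionL2.
(* Here matrix adjointability enters: linearity over scalars does not carry the matrix coefficients
   [A k] through [T] and [V]. Moving both operators to the other argument leaves the finite sums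
   outside, where the products agree term by term. *)
have TV n x : L2 x -> rip (T (F n)) x = rip (V (S n)) x.
  move=> hx.
  have e k : mip mu (E k) (T' x) = mip mu (E' k) (V' x).
    apply: etrans (esym (aT _ _ (hE k) hx)) _; apply: etrans _ (aV _ _ (hE' k) hx).
    exact: (eqL2_mip _ _ _ (hT _ (hE k)) (hV _ (hE' k)) hx (eTV k)).
  apply: eq_mip_rip; apply: etrans (aT _ _ (hF n) hx) _.
  apply: etrans (mip_suml _ _ _ _ hE (hT' _ hx)) _.
  apply: esym; apply: etrans (aV _ _ (hS n) hx) _.
  apply: etrans (mip_suml _ _ _ _ hE' (hV' _ hx)) _.
  by apply: eq_bigr => k _; exact: (f_equal (mulmx (A k)) (esym (e k))).
have FS n : rip (F n) (F n) = rip (S n) (S n).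
  apply: eq_mip_rip.
  apply: etrans (expansion_gram _ _ _ hE) _; apply: esym.
  apply: etrans (expansion_gram _ _ _ hE') _.
  apply: eq_bigr => k _.
  have e : \sum_(j < n) A j *m mip mu (E' j) (E' k) = \sum_(j < n) A j *m mip mu (E j) (E k).
    by apply: eq_bigr => j _; exact: (f_equal (mulmx (A j)) (etrans (gE' j k) (esym (gE j k)))).
  exact: (f_equal (fun P => A k *m adjmx P) e).
pose del n := rip (h - S n) (h - S n).
have cdel : del @ \oo --> (0 : R) by exact: cE' h hh.
(* [M] bounds the form of [T], since 2 <T F, F> <= |T F|^2 + |F|^2. One factor 2 in the constant
   below comes from the square of <V (h - S n), x> + <T (F n), x>, the other from |S n|^2 <= 2 |h|^2
   + 2 |h - S n|^2; the terms with [del n] vanish in the limit. *)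
pose M := `|KT| + 1.
exists (4 * M * rip h h) => x hx.
set q := rip (T x) x; have q0 : 0 <= q by exact: positive_rip.
have M0 : 0 <= M by rewrite /M addr_ge0.
have bound n : rip g x ^+ 2 <=
    4 * M * rip h h * q + (4 * M * q + 2 * `|KV| * rip x x) * del n.
  have hhS := siB Bin _ _ hh (hS n).
  have hVh := hV _ hh; have hVS := hV _ (hS n); have hVhS := hV _ hhS.
  have e1 : rip g x = rip (V (h - S n)) x + rip (T (F n)) x.
    apply: (split_by _ _ _ _ _ (TV n x hx) (eqL2_rip _ _ _ hVh hg hx gh)).
    exact: (linear_ripB V hV lV _ _ _ hh (hS n) hx).
  have e2 : rip (V (h - S n)) x ^+ 2 <= `|KV| * del n * rip x x.
    apply: le_trans (si_CS Bin _ _ hVhS hx) _.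
    apply: ler_wpM2r; first exact: (si_ge0 Bin).
    apply: le_trans (bV _ hhS) _; apply: ler_wpM2r; last exact: ler_norm.
    exact: (si_ge0 Bin).
  have F0 := si_ge0 Bin _ (hF n).
  have e3 : rip (T (F n)) (F n) <= M * rip (F n) (F n).
    apply: (form_le _ _ _ _ (si_le2 Bin _ _ (hT _ (hF n)) (hF n)) _ F0 (normr_ge0 KT)).
    exact: (le_trans (bT _ (hF n)) (ler_wpM2r F0 (ler_norm KT))).
  have e4 : rip (F n) (F n) <= 2 * rip h h + 2 * del n.
    have eq_le (p p' u : R) : p = p' -> p' <= u -> p <= u by move=> ->.
    exact: (eq_le _ _ _ (FS n) (si_sq_leB Bin _ _ hh (hS n))).
  have e5 : rip (T (F n)) x ^+ 2 <= M * (2 * rip h h + 2 * del n) * q.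
    exact: (le_trans (si_CS Tin _ _ (hF n) hx)
      (ler_wpM2r q0 (le_trans e3 (ler_wpM2l M0 e4)))).
  exact: (sq_le (rip g x) (rip (V (h - S n)) x) (rip (T (F n)) x) M `|KV| (rip h h) (del n) (rip x x) q e1 e2 e5).
have cb : (fun n => 4 * M * rip h h * q + (4 * M * q + 2 * `|KV| * rip x x) * del n) @ \oo
    --> 4 * M * rip h h * q + (4 * M * q + 2 * `|KV| * rip x x) * 0.
  by apply: cvgD; [exact: cvg_cst | apply: cvgM => //; exact: cvg_cst].
rewrite mulr0 addr0 in cb.
rewrite -(cvg_lim (@Rhausdorff R) cb); apply: limr_ge; first by apply/cvg_ex; eexists; exact: cb.
exact: nearW.
Qed.

End RieszDomination.

Theorem theorem3p13 (R : realType) (G : topologicalZmodType)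
  (mu : {measure set (Gborel G) -> \bar R}) (s r : nat)
  (hG_lc : locally_compact [set: G]) (hG_met : metrizable R G)
  (hG_sc : sigma_compact G) (hmu : haar_measure mu)
  (hs : (0 < s)%N) (hr : (0 < r)%N)
  (T Om : (G -> 'M[R[i]]_(s, r)) -> (G -> 'M[R[i]]_(s, r)))
  (E : nat -> (G -> 'M[R[i]]_(s, r))) :
  positiveL2 mu T -> positiveL2 mu Om ->
  adjointable mu T -> adjointable mu Om ->
  mv_onb mu E ->
  mv_riesz mu (fun k => T (E k)) ->
  (forall f, isL2 mu f -> ipL2 mu (T f) f <= ipL2 mu (Om f) f) ->
  mv_riesz mu (fun k => Om (E k)).
Proof.
move=> pT pO aT aO onbE rT TO.
have Bin := @rip_semi_inner R G mu s r.
have compl := @rip_complete R G mu s r.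
have [bO sO _] := pO; have [hO lO [K bK]] := bO.
have Oin := positive_form _ pO.
have lin := @linear_rip R G mu s r Om hO lO.
have [c [c0 coer]] : exists c : R, 0 < c /\
    forall x, isL2 mu x -> c * re_ip mu x x <= re_ip mu (Om x) x.
  apply: (coercive_of_dominated Bin compl) => [x hx|a x hx|g hg].
  - exact: positive_rip pO x hx.
  - by rewrite (siZl Oin) ?(siZr Oin) ?expr2 ?mulrA //; exact: (siZ Bin).
  (* Domination passes from [T] to the larger form of [Om] once the constant is replaced by its
     absolute value. *)
  - have [M MP] := riesz_dominated _ _ pT aT onbE rT g hg.
    exists `|M| => x hx; apply: le_trans (MP x hx) _.
    apply: le_trans (_ : `|M| * re_ip mu (T x) x <= _).
      by apply: ler_wpM2r; [exact: positive_rip pT x hx | exact: ler_norm].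
    have TOx : re_ip mu (T x) x <= re_ip mu (Om x) x.
      by have := TO x hx; rewrite lecE => /andP[_ h]; exact: h.
    exact: (ler_wpM2l (normr_ge0 M) TOx).
exists E, Om; split; [exact: onbE|exact: bO| |exact: aO|]; last first.
  move=> k; have hk : isL2 mu (Om (E k)) by apply: hO; have [] := onbE.
  exact: etrans (siBl Bin _ _ _ hk hk (siB Bin _ _ hk hk)) (subrr _).
split => [f g hf hg fg|g hg].
  exact: (coercive_inj Bin Om hO lin c c0 coer).
exact: (coercive_surj Bin compl Om hO lin K c bK c0 coer).
Qed.
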